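(* Let $(M,F,\mathfrak{m})$ be a Finsler metric measure manifold with $\mathfrak{m}(M)=1$ which has exponential concentration, i.e. there are positive constants $C$ and $c$ such that $\alpha_{(M,F,\mathfrak{m})}(r)\le Ce^{-cr}$ for every $r>0$. Then, for $q\ge1$, $(M,F,\mathfrak{m})$ satisfies $(1,q)$-Moment concentration.
   Context: A Finsler metric on a smooth manifold $M$ is a function $F:TM\to[0,\infty)$ that is $C^\infty$ on $TM\setminus\{0\}$, satisfies $F(x,\lambda y)=\lambda F(x,y)$ for $\lambda>0$, and for which $g_{ij}(x,y)=\frac12 (F^2)_{y^iy^j}(x,y)$ is positive definite for every nonzero $y\in T_xM$ ($F$ need not be reversible). A Finsler metric measure manifold $(M,F,\mathfrak{m})$ is a Finsler manifold $(M,F)$ with a positive smooth measure $\mathfrak{m}$. $M$ is connected, and the (possibly asymmetric) distance $d_F:M\times M\to[0,\infty)$ is $d_F(x_1,x_2)=\inf_\gamma\int_0^1F(\gamma(t),\dot\gamma(t))\,dt$ over $C^1$ curves $\gamma:[0,1]\to M$ from $x_1$ to $x_2$. For $A\subset M$, $r>0$: $B^{+}(A,r)=\{x\mid\inf_{z\in A}d_F(z,x)<r\}$ and $B^{-}(A,r)=\{x\mid\inf_{z\in A}d_F(x,z)<r\}$. The concentration function is $$\alpha_{(M,F,\mathfrak{m})}(r)=\sup\left\{1-\min\{\mathfrak{m}(B^{+}(A,r)),\mathfrak{m}(B^{-}(A,r))\}\;\middle|\;A\subset M\text{ Borel},\ \mathfrak{m}(A)\ge\tfrac12\right\},\quad r>0.$$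 A function $f:M\to\mathbb{R}$ is 1-Lipschitz if $f(z)-f(x)\le d_F(x,z)$ for all $x,z\in M$. Given $p,q\ge1$, $(M,F,\mathfrak{m})$ satisfies $(p,q)$-Moment concentration if there is a positive constant $C$ such that for any 1-Lipschitz function $f$, $\left\|f-\int_Mf\,d\mathfrak{m}\right\|_{L^q(\mathfrak{m})}^p\le\frac{q}{C}$. *)

(* Defs.v *)
From mathcomp Require Import all_boot all_order all_algebra.
From mathcomp Require Import all_classical all_reals all_analysis.

Set Implicit Arguments.
Unset Strict Implicit.
Unset Printing Implicit Defensive.

Import Order.TTheory GRing.Theory Num.Theory.
Import numFieldNormedType.Exports.

Local Open Scope classical_set_scope.
Local Open Scope ring_scope.

(* Meant for U open. In finite dimension, [f] is C^(k+1) iff it is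
   differentiable with C^k directional derivatives. *)
Fixpoint Ck (R : realType) (V W : normedModType R) (k : nat) (U : set V)
    (f : V -> W) : Prop :=
  if k is k'.+1 then
    (forall x, U x -> differentiable f x) /\ (forall v : V, Ck k' U ('D_v f))
  else forall x, U x -> {for x, continuous f}.

Definition smooth_on (R : realType) (V W : normedModType R) (U : set V)
    (f : V -> W) : Prop :=
  forall k, Ck k U f.

(* [cmap] and [cinv] are total; only their values on [cdom] and on
   [cmap @` cdom] matter. *)
Record chart (R : realType) (n : nat) (M : ptopologicalType) := Chart {
  cdom : set M ;
  cmap : M -> 'rV[R]_n ;
  cinv : 'rV[R]_n -> M ;
  cdom_open : open cdom ;
  cimg_open : open (cmap @` cdom) ;
  cmapK : forall x, cdom x -> cinv (cmap x) = x ;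
  cmap_continuous : forall x, cdom x -> {for x, continuous cmap} ;
  cinv_continuous : forall u, (cmap @` cdom) u -> {for u, continuous cinv} }.

Definition transition (R : realType) (n : nat) (M : ptopologicalType)
    (a b : chart R n M) : 'rV[R]_n -> 'rV[R]_n :=
  cmap b \o cinv a.

(* M is pointed only because the library's generated sigma-algebras are. *)
Record smooth_manifold (R : realType) (n : nat) (M : ptopologicalType) :=
  SmoothManifold {
  chart_index : Type ;
  atlas : chart_index -> chart R n M ;
  atlas_cover : forall x, exists i, cdom (atlas i) x ;
  atlas_smooth : forall i j,
    smooth_on (cmap (atlas i) @` (cdom (atlas i) `&` cdom (atlas j)))
              (transition (atlas i) (atlas j)) ;
  manifold_hausdorff : hausdorff_space M ;
  manifold_second_countable : second_countable (T := M) }.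

(* A tangent vector at x is represented by the set of all pairs (i, v) where i
   is a chart around x and v are the components of the vector in that chart;
   components change by the differentials of the transition maps. *)
Definition tangent_set (R : realType) (n : nat) (M : ptopologicalType)
    (X : smooth_manifold R n M) : Type :=
  set (chart_index X * 'rV[R]_n).

(* The tangent vector at x with components v in the i-th chart. *)
Definition tvec (R : realType) (n : nat) (M : ptopologicalType)
    (X : smooth_manifold R n M) (x : M) (i : chart_index X) (v : 'rV[R]_n) :
    tangent_set X :=
  [set jw | cdom (atlas jw.1) x /\
     jw.2 = 'd (transition (atlas i) (atlas jw.1)) (cmap (atlas i) x) v].

(* g_kl(x, y) = 1/2 (F^2)_{y^k y^l}(x, y) in the i-th chart. *)
Definition fundamental_tensor (R : realType) (n : nat) (M : ptopologicalType)
    (X : smooth_manifold R n M) (F : M -> tangent_set X -> R)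
    (i : chart_index X) (x : M) (y : 'rV[R]_n) : 'M[R]_n :=
  \matrix_(k, l) (2^-1 *
    'D_(delta_mx 0 l : 'rV[R]_n)
      ('D_(delta_mx 0 k : 'rV[R]_n) (fun v => F x (tvec x i v) ^+ 2)) y).

Definition positive_definite (R : realType) (n : nat) (G : 'M[R]_n) : Prop :=
  forall v : 'rV[R]_n, v != 0 -> 0 < (v *m G *m v^T) 0 0.

(* F is a function on TM: the values of [finsler] at arguments (x, xi) where xi
   is not a tangent vector at x play no role. *)
Record finsler_metric (R : realType) (n : nat) (M : ptopologicalType)
    (X : smooth_manifold R n M) := FinslerMetric {
  finsler :> M -> tangent_set X -> R ;
  finsler_ge0 : forall i x y, cdom (atlas i) x -> 0 <= finsler x (tvec x i y) ;
  finsler_homogeneous : forall i x y (l : R), cdom (atlas i) x -> 0 < l ->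
    finsler x (tvec x i (l *: y)) = l * finsler x (tvec x i y) ;
  finsler_smooth : forall i : chart_index X,
    smooth_on
      [set uy : 'rV[R]_n * 'rV[R]_n |
        (cmap (atlas i) @` cdom (atlas i)) uy.1 /\ uy.2 != 0]
      (fun uy : 'rV[R]_n * 'rV[R]_n =>
        finsler (cinv (atlas i) uy.1) (tvec (cinv (atlas i) uy.1) i uy.2)) ;
  finsler_convex : forall i x y, cdom (atlas i) x -> y != 0 ->
    positive_definite (fundamental_tensor finsler i x y) }.

(* C^1 maps [0, 1] -> M, as maps on the real line that are C^1 on an open
   neighbourhood of [0, 1]. *)
Definition C1_curve (R : realType) (n : nat) (M : ptopologicalType)
    (X : smooth_manifold R n M) (g : R -> M) : Prop :=
  exists J : set R, [/\ open J, `[0, 1] `<=` J,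
    (forall t, J t -> {for t, continuous g}) &
    forall i : chart_index X,
      Ck 1 (J `&` g @^-1` cdom (atlas i)) (cmap (atlas i) \o g)].

Definition velocity (R : realType) (n : nat) (M : ptopologicalType)
    (X : smooth_manifold R n M) (g : R -> M) (t : R) : tangent_set X :=
  [set jw | cdom (atlas jw.1) (g t) /\
     jw.2 = derive1 (cmap (atlas jw.1) \o g) t].

Definition curve_length (R : realType) (n : nat) (M : ptopologicalType)
    (X : smooth_manifold R n M) (F : finsler_metric X) (g : R -> M) : \bar R :=
  (\int[lebesgue_measure]_(t in `[0%R, 1%R]) (F (g t) (velocity g t))%:E)%E.

(* Extended real-valued so that no junk value is needed; it is finite as soon as
   M is connected. *)
Definition finsler_dist (R : realType) (n : nat) (M : ptopologicalType)
    (X : smooth_manifold R n M) (F : finsler_metric X) (x1 x2 : M) : \bar R :=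
  ereal_inf [set curve_length F g |
    g in [set g | [/\ C1_curve X g, g 0 = x1 & g 1 = x2]]].

Definition fwd_ball (R : realType) (n : nat) (M : ptopologicalType)
    (X : smooth_manifold R n M) (F : finsler_metric X) (A : set M) (r : R) :
    set M :=
  [set x | (ereal_inf [set finsler_dist F z x | z in A] < r%:E)%E].

Definition bwd_ball (R : realType) (n : nat) (M : ptopologicalType)
    (X : smooth_manifold R n M) (F : finsler_metric X) (A : set M) (r : R) :
    set M :=
  [set x | (ereal_inf [set finsler_dist F x z | z in A] < r%:E)%E].

Notation borel M := (g_sigma_algebraType (@open M)).

(* Integral over R^n with respect to Lebesgue measure, written as an iterated
   one-dimensional integral; by Tonelli the two agree on nonnegative Borel
   functions. *)
Fixpoint lebesgue_int (R : realType) (n : nat) :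
    ('rV[R]_n -> \bar R) -> \bar R :=
  match n with
  | 0 => fun h => h 0
  | n'.+1 => fun h => (\int[lebesgue_measure]_(x in [set: R])
      lebesgue_int (fun v : 'rV[R]_n' => h (row_mx (x%:M : 'rV[R]_1) v)))%E
  end.

(* In every chart, m has a positive smooth density with respect to Lebesgue
   measure. *)
Definition smooth_positive_measure (R : realType) (n : nat)
    (M : ptopologicalType) (X : smooth_manifold R n M)
    (m : {measure set (borel M) -> \bar R}) : Prop :=
  forall i : chart_index X, exists rho : 'rV[R]_n -> R,
    [/\ smooth_on (cmap (atlas i) @` cdom (atlas i)) rho,
        (forall u, (cmap (atlas i) @` cdom (atlas i)) u -> 0 < rho u) &
        forall A : set (borel M), measurable A -> A `<=` cdom (atlas i) ->
          m A = lebesgue_int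
                  (fun u => (rho u * \1_(cmap (atlas i) @` A) u)%:E)].

Definition concentration_function (R : realType) (n : nat)
    (M : ptopologicalType) (X : smooth_manifold R n M) (F : finsler_metric X)
    (m : {measure set (borel M) -> \bar R}) (r : R) : \bar R :=
  ereal_sup [set (1 - Order.min (m (fwd_ball F A r)) (m (bwd_ball F A r)))%E |
    A in [set A : set (borel M) | measurable A /\ ((2^-1)%:E <= m A)%E]].

Definition exponential_concentration (R : realType) (n : nat)
    (M : ptopologicalType) (X : smooth_manifold R n M) (F : finsler_metric X)
    (m : {measure set (borel M) -> \bar R}) : Prop :=
  exists C c : R, [/\ 0 < C, 0 < c & forall r : R, 0 < r ->
    (concentration_function F m r <= (C * expR (- (c * r)))%:E)%E].

Definition one_lipschitz (R : realType) (n : nat) (M : ptopologicalType)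
    (X : smooth_manifold R n M) (F : finsler_metric X) (f : M -> R) : Prop :=
  forall x z : M, ((f z - f x)%:E <= finsler_dist F x z)%E.

(* Integrability of f, implicit in the mean of f, is part of the claim. *)
Definition moment_concentration (R : realType) (n : nat)
    (M : ptopologicalType) (X : smooth_manifold R n M) (F : finsler_metric X)
    (m : {measure set (borel M) -> \bar R}) (p q : R) : Prop :=
  exists C : R, 0 < C /\ forall f : borel M -> R, one_lipschitz F f ->
    m.-integrable [set: borel M] (EFin \o f) /\
    (Lnorm m q%:E (fun x => (f x - \int[m]_x f x)%R%:E) `^ p
       <= (q / C)%:E)%E.

(* Main.v *)
Require Import Defs.
From mathcomp Require Import all_boot all_order all_algebra.
From mathcomp Require Import all_classical all_reals all_analysis.
From mathcomp Require Import measurable_realfun ring lra.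

Set Implicit Arguments.
Unset Strict Implicit.
Unset Printing Implicit Defensive.

(* For a 1-Lipschitz f choose t with m(f <= t) and m(f >= t - 1) both at least
   1/2. The forward r-ball of the first set lies in {f < t + r} and the backward
   r-ball of the second in {f > t - 1 - r}, so exponential concentration bounds
   both tails of f - t exponentially, uniformly in f. Hence the mean E of
   exp(a |f - t|) is bounded for a = c / 2, which controls |mean f - t| and then
   the L^q norm of f - mean f through y^q <= (q/a)^q exp(a y).

   Concentration speaks of m only on Borel sets, so the balls must be shown to be
   measurable and f to be continuous. Both follow from one fact: the endpoint of a
   C^1 curve can be moved to any nearby point at an arbitrarily small cost in
   length, by adding a multiple of a cutoff function in a chart. *)

Import Order.TTheory GRing.Theory Num.Theory.
Import numFieldNormedType.Exports.
Local Open Scope classical_set_scope.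
Local Open Scope ring_scope.

(** * C^1 curves in normed spaces *)

(** A pointwise form of [Ck 1], so that gluing and changes of chart can be checked one time at a
    time. Derivability is asked near [t] because [derive1] is total: its continuity at [t] says
    something about [c] only where the derivative exists. *)
Definition C1_at (R : realType) (W : normedModType R) (c : R -> W) (t : R) :=
  (\forall s \near t, derivable c s 1) /\ {for t, continuous (derive1 c)}.

Lemma C1_atP (R : realType) (W : normedModType R) (U : set R) (c : R -> W) :
  open U -> Ck 1 U c <-> forall t, U t -> C1_at c t.
Proof.
move=> oU; split=> [[dc Dc] t Ut|C1c].
  split.
    have : nbhs t U by rewrite nbhsE; exists U.
    by apply: filterS => s Us; apply/derivable1_diffP/dc.
  have := Dc 1 t Ut; rewrite (_ : 'D_1 c = derive1 c)//.
  by apply/funext => s; rewrite derive1E.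
have dc x : U x -> differentiable c x.
  by move=> /C1c[+ _] => /nbhs_singleton/derivable1_diffP.
split=> // v t Ut.
have oUt : nbhs t U by rewrite nbhsE; exists U.
(* On the line every directional derivative is a multiple of [derive1], so continuity of the latter
   suffices. *)
have Dv : {near t, (fun s => v *: derive1 c s) =1 'D_v c}.
  near=> s.
  have Us : U s by near: s.
  rewrite deriveE; last exact: dc.
  by rewrite diff1E//; exact: dc.
have [_ cc] := C1c t Ut.
rewrite /prop_for /continuous_at -(nbhs_singleton Dv).
apply: cvg_trans; first exact: (near_eq_cvg Dv).
by apply: cvgZl_tmp; exact: cc.
Unshelve. all: by end_near. Qed.

Lemma C1_at_cst (R : realType) (W : normedModType R) (w : W) (t : R) :
  C1_at (fun=> w) t.
Proof.
split; first by near=> s; exact: derivable_cst.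
rewrite (_ : derive1 _ = cst 0); first exact: cst_continuous.
by apply/funext => s; exact: derive1_cst.
Unshelve. all: by end_near. Qed.

Lemma near_eq_derive1 (R : realType) (W : normedModType R) (c d : R -> W) t :
  (\forall s \near t, c s = d s) -> derive1 c t = derive1 d t.
Proof. by move=> cd; rewrite !derive1E; apply: near_eq_derive. Qed.

Lemma C1_at_near_eq (R : realType) (W : normedModType R) (c d : R -> W) t :
  (\forall s \near t, c s = d s) -> C1_at c t -> C1_at d t.
Proof.
move=> cd [dc cc]; have cd2 := near_join cd; split.
  by near=> s; apply: (@near_eq_derivable _ _ _ c); [near: s|near: s; exact: dc].
have cd' : {near t, derive1 c =1 derive1 d}.
  by near=> s; apply: near_eq_derive1; near: s.
rewrite /prop_for /continuous_at -(nbhs_singleton cd').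
by apply: cvg_trans cc; exact: (near_eq_cvg cd').
Unshelve. all: by end_near. Qed.

Lemma derive1_diff_comp (R : realType) (V W : normedModType R) (T : V -> W)
    (c : R -> V) t :
  derivable c t 1 -> differentiable T (c t) ->
  derive1 (T \o c) t = 'd T (c t) (derive1 c t).
Proof.
move=> /derivable1_diffP dc dT.
rewrite derive1E'; last exact: differentiable_comp.
by rewrite diff_comp//= -derive1E'.
Qed.

Lemma C1_at_continuous (R : realType) (W : normedModType R) (c : R -> W) t :
  C1_at c t -> {for t, continuous c}.
Proof.
by move=> [/nbhs_singleton dc _]; exact/differentiable_continuous/derivable1_diffP.
Qed.

(** The chain rule is expanded in coordinates: near [t] the derivative is a finite sum of
    coordinates of the derivative of [c] times partial derivatives of [T]. Continuity is then needed
    only for directional derivatives, which is what [Ck] provides, and not for the differential as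
    an operator. *)
Lemma C1_at_comp (R : realType) n (W : normedModType R) (T : 'rV[R]_n -> W)
    (c : R -> 'rV[R]_n) t :
  (\forall u \near c t, differentiable T u) ->
  (forall v, {for c t, continuous ('D_v T)}) ->
  C1_at c t -> C1_at (T \o c) t.
Proof.
move=> dT cT C1c; have cc := C1_at_continuous C1c.
have [dc c'c] := C1c.
have dTc : \forall s \near t, differentiable T (c s) by exact: (cc _ dT).
split.
  near=> s; apply/derivable1_diffP/differentiable_comp; last by near: s.
  by apply/derivable1_diffP; near: s.
have E : {near t, (fun s => \sum_(k < n) (derive1 c s) 0 k *:
     'D_(delta_mx 0 k : 'rV[R]_n) T (c s)) =1 derive1 (T \o c)}.
  near=> s.
  have dTcs : differentiable T (c s) by near: s.
  have dcs : derivable c s 1 by near: s.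
  apply: etrans (esym (derive1_diff_comp dcs dTcs)).
  rewrite [in RHS](row_sum_delta (derive1 c s)) linear_sum/=.
  by apply: eq_bigr => k _; rewrite linearZ/= deriveE.
rewrite /prop_for /continuous_at -(nbhs_singleton E).
apply: cvg_trans; first exact: (near_eq_cvg E).
apply: cvg_big => [|k _]; [exact: add_continuous|]; apply: cvgZ.
  apply: (@continuous_comp _ _ _ (derive1 c) (fun M : 'rV[R]_n => M 0 k)) => //.
  exact: coord_continuous.
by apply: (@continuous_comp _ _ _ c ('D_(delta_mx 0 k : 'rV[R]_n) T)).
Unshelve. all: by end_near. Qed.

Lemma derive1_addZ (R : realType) (W : normedModType R) (c : R -> W) (p : R -> R)
    (w : W) t :
  derivable c t 1 -> derivable p t 1 ->
  derive1 (fun s => c s + p s *: w) t = derive1 c t + derive1 p t *: w.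
Proof.
move=> dc /derivable1_diffP dp.
rewrite [LHS]derive1E deriveD//; last first.
  by apply/derivable1_diffP/differentiableZl.
rewrite -derive1E; congr (_ + _).
rewrite deriveE; last exact: differentiableZl.
by rewrite diffZl// -derive1E'.
Qed.

Lemma C1_at_addZ (R : realType) (W : normedModType R) (c : R -> W) (p : R -> R)
    (w : W) t :
  C1_at c t -> C1_at p t -> C1_at (fun s => c s + p s *: w) t.
Proof.
move=> [dc cc] [dp cp]; split.
  near=> s.
  have dcs : derivable c s 1 by near: s.
  have dps : derivable p s 1 by near: s.
  apply: derivableD => //.
  by apply/derivable1_diffP/differentiableZl/derivable1_diffP.
have E : {near t, (fun s => derive1 c s + derive1 p s *: w) =1 derive1 (fun s => c s + p s *: w)}.
  near=> s.
  have dcs : derivable c s 1 by near: s.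
  have dps : derivable p s 1 by near: s.
  by rewrite derive1_addZ.
rewrite /prop_for /continuous_at -(nbhs_singleton E).
apply: cvg_trans; first exact: (near_eq_cvg E).
by apply: cvgD => //; apply: cvgZr_tmp.
Unshelve. all: by end_near. Qed.

(** * A C^1 cutoff function on the line *)

Lemma is_derive_sqr_max0 (R : realType) (x : R) :
  is_derive x 1 (fun y : R => Num.max 0 y ^+ 2) (2 * Num.max 0 x).
Proof.
have [x0|x0|->] := ltgtP x 0.
- rewrite mulr0.
  apply: (near_eq_is_derive (f := cst 0)) => //.
  near=> y; rewrite /= max_l ?expr0n//.
  by apply: ltW; near: y; exact: lt_nbhsl.
- apply: (near_eq_is_derive (f := fun y : R => y ^+ 2)).
    near=> y; rewrite /= max_r//.
    by apply: ltW; near: y; exact: lt_nbhsr.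
  rewrite (_ : (fun y : R => y ^+ 2) = id ^+ 2); last by apply/funext.
  apply: is_derive_eq.
  by rewrite expr1 scaler1 mulrC mulr_natr.
(* At the corner the square makes the difference quotient at most [|h|] in absolute value. *)
- rewrite mulr0.
  have D : h^-1 *: (Num.max (0 : R) (h *: 1 + 0) ^+ 2 - Num.max (0 : R) 0 ^+ 2) @[h --> 0^'] --> (0 : R).
    apply/cvgrPdist_le => e e0; near=> h.
    have h0 : h != 0 by near: h; exact: nbhs_dnbhs_neq.
    rewrite sub0r normrN maxxx expr0n subr0 normrZ normfV normrX.
    rewrite ler_pdivrMl ?normr_gt0// scaler1 addr0.
    have he : `|h| <= e by near: h; exact: dnbhs0_le.
    have hh : `|Num.max 0 h| <= `|h|.
      by case: (leP 0 h) => //; rewrite normr0.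
    by rewrite expr2 ler_pM ?(le_trans hh).
  by apply: DeriveDef; [apply/cvg_ex; exists 0|apply: cvg_lim].
Unshelve. all: by end_near. Qed.

(** The bump (1 - u^2)_+^2 with u = (t - t0) / d: only C^1, which is enough to perturb C^1 curves,
    and with an explicit derivative. *)
Definition cutoff (R : realType) (t0 d t : R) : R :=
  Num.max 0 (1 - ((t - t0) / d) ^+ 2) ^+ 2.

Definition cutoff' (R : realType) (t0 d t : R) : R :=
  2 * Num.max 0 (1 - ((t - t0) / d) ^+ 2) * (- (2 * ((t - t0) / d) / d)).

Lemma is_derive_cutoff (R : realType) (t0 d t : R) :
  is_derive t 1 (cutoff t0 d) (cutoff' t0 d t).
Proof.
pose q : R -> R := cst 1 - (d^-1 *: (id - cst t0)) ^+ 2.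
rewrite (_ : cutoff t0 d = (fun y => Num.max 0 y ^+ 2) \o q); last first.
  apply/funext => s; rewrite /cutoff /q /=.
  by rewrite [in RHS]/GRing.add/= /GRing.opp/= mulrC.
have dq : is_derive t 1 q (- (2 * ((t - t0) / d) / d)).
  apply: is_derive_eq.
  rewrite !subr0 sub0r expr1 /GRing.scale/= mulr1 /cst/=.
  by congr (- (2 * _ / d)); exact: mulrC.
have qE : q t = 1 - ((t - t0) / d) ^+ 2.
  by rewrite [RHS]/(1 - _) mulrC.
rewrite /cutoff' -qE.
exact: (is_derive1_comp (is_derive_sqr_max0 _) dq).
Qed.

Lemma C1_at_cutoff (R : realType) (t0 d t : R) : C1_at (cutoff t0 d) t.
Proof.
split; first by near=> s; case: (is_derive_cutoff t0 d s).
rewrite (_ : derive1 _ = cutoff' t0 d); last first.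
  by apply/funext => s; rewrite derive1E; case: (is_derive_cutoff t0 d s).
have cq : {for t, continuous (fun s : R => (s - t0) / d)}.
  by apply: cvgMr_tmp; apply: cvgB; [exact: cvg_id|exact: cvg_cst].
apply: cvgM; first apply: cvgM; first exact: cvg_cst.
  apply: (@continuous_max _ _ (cst 0) (fun s => 1 - ((s - t0) / d) ^+ 2)).
    exact: cvg_cst.
  by apply: cvgB; [exact: cvg_cst|apply: cvgM].
by apply: cvgN; apply: cvgMr_tmp; apply: cvgM => //; exact: cvg_cst.
Unshelve. all: by end_near. Qed.

Lemma cutoff_itv (R : realType) (t0 d t : R) : 0 <= cutoff t0 d t <= 1.
Proof.
rewrite /cutoff exprn_ge0 ?le_max ?lexx//= expr_le1// ?le_max ?lexx//.
by rewrite ge_max ler01 gerBl sqr_ge0.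
Qed.

Lemma cutoff_out (R : realType) (t0 d t : R) : 0 < d -> d <= `|t - t0| -> cutoff t0 d t = 0.
Proof.
move=> d0 dt; rewrite /cutoff max_l ?expr0n// subr_le0.
rewrite -real_normK ?num_real// exprn_ege1//.
by rewrite normrM normfV (gtr0_norm d0) ler_pdivlMr ?mul1r.
Qed.

Lemma cutoff_center (R : realType) (t0 d : R) : cutoff t0 d t0 = 1.
Proof. by rewrite /cutoff subrr mul0r expr0n/= subr0 max_r ?expr1n. Qed.

(** The derivative vanishes off the support; on it both [|u|] and the truncated factor are at most
    1, which leaves the two factors 2. *)
Lemma cutoff'_bound (R : realType) (t0 d t : R) : 0 < d -> `|cutoff' t0 d t| <= 4 / d.
Proof.
move=> d0; rewrite /cutoff'; move: ((t - t0) / d) => u.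
have [u1|u1] := lerP 1 `|u|.
  rewrite max_l ?mulr0 ?mul0r ?normr0 ?divr_ge0 ?(ltW d0)//.
  by rewrite subr_le0 -real_normK ?num_real// -[leLHS](expr1n _ 2) lerXn2r ?nnegrE.
rewrite normrM normrN !normrM (ger0_norm (_ : 0 <= 2))//.
rewrite (ger0_norm (_ : 0 <= Num.max _ _)) ?le_max ?lexx// normfV (gtr0_norm d0).
rewrite mulrA ler_pM2r ?invr_gt0//.
have : Num.max 0 (1 - u ^+ 2) <= 1 by rewrite ge_max ler01 gerBl sqr_ge0.
have : 0 <= Num.max 0 (1 - u ^+ 2) by rewrite le_max lexx.
by have := normr_ge0 u; nra.
Qed.

(** * Comparison of integrals of possibly nonmeasurable functions *)

Section nonmeasurable_integral.
Context d (T : measurableType d) (R : realType) (mu : {measure set T -> \bar R}).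
Import HBNNSimple.
Local Open Scope ereal_scope.

(* No measurability is needed: the integral of a nonnegative function is the
   supremum of the integrals of the simple functions below it. This spares us
   proving that the speed of a curve is measurable. *)
Lemma ge0_le_integral_nonmeas (D : set T) (f g : T -> \bar R) :
  (forall x, D x -> 0 <= f x) -> (forall x, D x -> f x <= g x) ->
  \int[mu]_(x in D) f x <= \int[mu]_(x in D) g x.
Proof.
move=> f0 fg; rewrite !ge0_integralE//; last first.
  by move=> x Dx; apply: le_trans (f0 _ Dx) (fg _ Dx).
apply: ereal_sup_le => _ [h hf <-]; exists h => // x.
apply: le_trans (hf x) _; rewrite /patch; case: ifPn => // /set_mem Dx; exact: fg.
Qed.

(** If a simple function [phi] lies below [f], then [psi], the positive part of [phi - h], is
    measurable and lies below [g]. Additivity is applied to [psi] and [h] only, so [f] and [g] may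
    be speeds of curves. *)
Lemma ge0_integral_le_addr (D : set T) (f g : T -> \bar R) (h : T -> R) :
  measurable D -> measurable_fun D h ->
  (forall x, D x -> 0 <= f x) -> (forall x, D x -> 0 <= g x) ->
  (forall x, D x -> (0 <= h x)%R) ->
  (forall x, D x -> f x <= g x + (h x)%:E) ->
  \int[mu]_(x in D) f x <= \int[mu]_(x in D) g x + \int[mu]_(x in D) (h x)%:E.
Proof.
move=> mD mh f0 g0 h0 fgh; rewrite ge0_integralE//.
apply: ge_ereal_sup => _ [phi phif <-].
pose psi x : R := Num.max 0%R (phi x - h x)%R.
have mphi : measurable_fun D phi by exact: measurable_funTS.
have mpsi : measurable_fun D psi.
  by apply: measurable_maxr => //; exact: measurable_funB.
rewrite -integralT_nnsfun//.
rewrite (_ : \int[mu]_x _ = \int[mu]_(x in D) (phi x)%:E); last first.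
  rewrite [RHS]integral_mkcond; apply: eq_integral => x _.
  rewrite /patch; case: ifPn => // xD.
  apply/eqP; rewrite eq_le !lee_fin fun_ge0 andbT.
  by have := phif x; rewrite /patch (negbTE xD).
apply: (@le_trans _ _ (\int[mu]_(x in D) ((psi x)%:E + (h x)%:E))).
  apply: ge0_le_integral_nonmeas => x Dx; first by rewrite lee_fin.
  by rewrite -EFinD lee_fin -lerBlDr le_max lexx orbT.
rewrite ge0_integralD//; last 3 first.
- by move=> x Dx; rewrite lee_fin le_max lexx.
- exact/measurable_EFinP.
- exact/measurable_EFinP.
rewrite leeD2r//; apply: ge0_le_integral_nonmeas => x Dx.
  by rewrite lee_fin le_max lexx.
have := phif x; rewrite /patch mem_set// => /le_trans/(_ (fgh x Dx)).
have := g0 x Dx; case: (g x) => [r| |]//; last by move=> *; rewrite leey.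
rewrite -EFinD !lee_fin => r0 H; rewrite ge_max r0/=; lra.
Qed.

End nonmeasurable_integral.

(** * Charts, velocities and moving the endpoint of a curve *)

Section manifold.
Context (R : realType) (n : nat) (M : ptopologicalType).

Lemma chart_nbhs (a : chart R n M) x : cdom a x -> nbhs x (cdom a).
Proof. by move=> ax; apply: open_nbhs_nbhs; split => //; exact: cdom_open. Qed.

Lemma chart_img_nbhs (a : chart R n M) x : cdom a x ->
  nbhs (cmap a x) (cmap a @` cdom a).
Proof.
by move=> ax; apply: open_nbhs_nbhs; split; [exact: cimg_open|exists x].
Qed.

Lemma overlap_nbhs (a b : chart R n M) x : cdom a x -> cdom b x ->
  nbhs (cmap a x) (cmap a @` (cdom a `&` cdom b)).
Proof.
move=> ax bx.
have cb : \forall u \near cmap a x, cdom b (cinv a u).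
  apply: (@cinv_continuous _ _ _ a); first by exists x.
  by rewrite cmapK//; exact: chart_nbhs.
apply: filterS2 (chart_img_nbhs ax) cb => _ [y ay <-].
by rewrite cmapK// => by_; exists y.
Qed.

Variable X : smooth_manifold R n M.

Lemma transition_near_differentiable (i j : chart_index X) x :
  cdom (atlas i) x -> cdom (atlas j) x ->
  \forall u \near cmap (atlas i) x,
    differentiable (transition (atlas i) (atlas j)) u.
Proof.
move=> ix jx; apply: filterS (overlap_nbhs ix jx).
by have [+ _] := @atlas_smooth _ _ _ X i j 1%N; exact.
Qed.

Lemma C1_at_transition (i j : chart_index X) (c : R -> 'rV[R]_n) t x :
  cdom (atlas i) x -> cdom (atlas j) x -> c t = cmap (atlas i) x ->
  C1_at c t -> C1_at (transition (atlas i) (atlas j) \o c) t.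
Proof.
move=> ix jx ctx; apply: C1_at_comp; rewrite ctx.
  exact: transition_near_differentiable.
move=> v; have [_ +] := @atlas_smooth _ _ _ X i j 1%N.
by move=> /(_ v); apply; exists x.
Qed.

(** Near [t] the reading of [g] in chart [j] is the transition map applied to its reading in chart
    [i], so the chain rule gives the transformation law of [tvec]. The properties of [F], which
    concern [tvec] only, thereby apply to velocities. *)
Lemma velocityE (g : R -> M) t (i : chart_index X) :
  cdom (atlas i) (g t) -> {for t, continuous g} ->
  derivable (cmap (atlas i) \o g) t 1 ->
  velocity (X := X) g t = tvec (g t) i (derive1 (cmap (atlas i) \o g) t).
Proof.
move=> igt gc dg.
have E (j : chart_index X) : cdom (atlas j) (g t) ->
    derive1 (cmap (atlas j) \o g) t =
    'd (transition (atlas i) (atlas j)) (cmap (atlas i) (g t))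
       (derive1 (cmap (atlas i) \o g) t).
  move=> jgt.
  have dT := nbhs_singleton (transition_near_differentiable igt jgt).
  apply: etrans (derive1_diff_comp dg dT).
  apply: near_eq_derive1.
  have : \forall s \near t, cdom (atlas i) (g s) := gc _ (chart_nbhs igt).
  by apply: filterS => s igs; rewrite /transition/= cmapK.
apply/seteqP; split => -[j w] [/= jgt ->]; (split; first exact: jgt).
  exact: E.
exact/esym/E.
Qed.

Lemma near_eq_velocity (g h : R -> M) t :
  (\forall s \near t, h s = g s) -> velocity (X := X) h t = velocity (X := X) g t.
Proof.
move=> hg; rewrite /velocity (nbhs_singleton hg).
have E (j : chart_index X) :
    derive1 (cmap (atlas j) \o h) t = derive1 (cmap (atlas j) \o g) t.
  by apply: near_eq_derive1; apply: filterS hg => s /= ->.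
by apply/funext => -[j w]; rewrite /= E.
Qed.

Lemma C1_curveP (g : R -> M) : C1_curve X g <->
  exists J : set R, [/\ open J, `[0, 1] `<=` J,
    (forall t, J t -> {for t, continuous g}) &
    forall (i : chart_index X) t, J t -> cdom (atlas i) (g t) ->
      C1_at (cmap (atlas i) \o g) t].
Proof.
have oU J i : open J -> (forall t, J t -> {for t, continuous g}) ->
    open (J `&` g @^-1` cdom (atlas (s := X) i)).
  move=> oJ gc; rewrite openE => t [Jt igt].
  apply: filterI; first by apply: open_nbhs_nbhs; split.
  exact: (gc t Jt _ (chart_nbhs igt)).
split=> -[J [oJ IJ gc gC1]]; exists J; split => // i.
  by move=> t Jt igt; have /(C1_atP _ (oU J i oJ gc)) := gC1 i; apply; split.
by apply/C1_atP; [exact: oU|move=> t [Jt igt]; exact: gC1].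
Qed.

Variable F : finsler_metric X.

(** Smoothness says nothing at the zero vector; homogeneity with factor 2 makes the value there
    equal to its double. *)
Lemma finsler_tvec0 i x : cdom (atlas i) x -> F x (tvec x i 0) = 0.
Proof.
move=> ix; have := finsler_homogeneous F 0 ix (ltr0n R 2 : 0 < 2).
by rewrite scaler0; lra.
Qed.

Lemma velocity_finsler_ge0 (g : R -> M) t :
  {for t, continuous g} ->
  (forall i, cdom (atlas i) (g t) -> C1_at (cmap (atlas (s := X) i) \o g) t) ->
  0 <= F (g t) (velocity (X := X) g t).
Proof.
move=> gc gC1; have [i igt] := atlas_cover X (g t).
rewrite (velocityE igt gc) ?finsler_ge0//.
by have [/nbhs_singleton] := gC1 i igt.
Qed.

(** [F] is continuous off the zero section and the unit sphere of the chart norm is compact, so [F]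
    is bounded on unit vectors over a neighbourhood of [x]; homogeneity extends the bound to all
    vectors. *)
Lemma finsler_local_bound i x : cdom (atlas i) x ->
  exists rho K : R, [/\ 0 < rho, 0 < K &
    forall u v, `|u - cmap (atlas i) x| < rho ->
      (cmap (atlas i) @` cdom (atlas i)) u /\
      F (cinv (atlas i) u) (tvec (cinv (atlas i) u) i v) <= K * `|v|].
Proof.
move=> ix; set u0 := cmap (atlas i) x.
pose Phi (uy : 'rV[R]_n * 'rV[R]_n) :=
  F (cinv (atlas i) uy.1) (tvec (cinv (atlas i) uy.1) i uy.2).
pose S : set 'rV[R]_n := [set v | `|v| = 1].
have cS : compact S.
  apply: bounded_closed_compact.
    exists 1; split => // y y1 v /= ->; exact: ltW.
  have -> : S = (fun v : 'rV[R]_n => `|v|) @^-1` [set 1] by [].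
  apply: closed_comp => [v _|]; [exact: norm_continuous|exact: closed_eq].
have cPhi v : S v -> {for (u0, v), continuous Phi}.
  move=> Sv; apply: (finsler_smooth F i 0); split => /=; first by exists x.
  by rewrite -normr_eq0 Sv oner_eq0.
(* The parameter of the covering argument is a pair (u, k) of a base point near [u0] and a large
   bound. Compactness then yields one neighbourhood and one bound valid on the whole sphere. *)
have /(_ _ (filter_prod (nbhs u0) (+oo%R : set_system R))
   (fun uk v => Phi (uk.1, v) <= uk.2)) :=
  (compact_near_coveringP S).1 cS.
case.
  move=> v Sv.
  have [[A B] /= [A0 Bv] AB] : nbhs (u0, v) [set uy | Phi uy < Phi (u0, v) + 1].
    by apply: (cvgr_lt _ (cPhi v Sv)); rewrite ltrDl.
  exists (B, A `*` [set k | Phi (u0, v) + 1 <= k]) => /=.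
    split => //; exists (A, [set k | Phi (u0, v) + 1 <= k]) => //=.
    by split => //; apply: nbhs_pinfty_ge; exact: num_real.
  move=> [v' [u k]] /= [Bv' [Au le_k]].
  by apply: le_trans le_k; apply/ltW; exact: (AB (u, v')).
move=> [A B] /= [A0 [k0 [_ Bk]]] AB.
have [rho /= rho0 rhoA] := (nbhs_ballP _ _).1 (filterI A0 (chart_img_nbhs ix)).
pose K := Num.max 1 (k0 + 1).
have BK : B K by apply: Bk; rewrite lt_max ltrDl ltr01 orbT.
exists rho, K; split => //; first by rewrite lt_max ltr01.
move=> u v uu0.
have [Au iu] : (A `&` cmap (atlas i) @` cdom (atlas i)) u.
  by apply: rhoA; rewrite -ball_normE/= distrC.
split=> //.
have icu : cdom (atlas i) (cinv (atlas i) u).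
  by case: iu => y iy <-; rewrite cmapK.
have [->|v0] := eqVneq v 0; first by rewrite finsler_tvec0// normr0 mulr0.
have nv0 : 0 < `|v| by rewrite normr_gt0.
have -> : v = `|v| *: (`|v|^-1 *: v).
  by rewrite scalerA divff ?scale1r// gt_eqF.
rewrite finsler_homogeneous// normrZ normr_id normrZ normfV normr_id.
rewrite (mulVf (lt0r_neq0 nv0)) mulr1 mulrC ler_pM2r//.
apply: (AB (u, K)) => //.
by rewrite /S/= normrZ normfV normr_id mulVf// lt0r_neq0.
Qed.
End manifold.

Section perturbation.
Context (R : realType) (n : nat) (M : ptopologicalType).
Context (X : smooth_manifold R n M) (F : finsler_metric X).

(* Stands in for the triangle inequality of the distance: concatenating C^1 curves
   does not give a C^1 curve. *)
Lemma endpoint_perturbation (g : R -> M) (t0 t1 e : R) :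
  C1_curve X g -> t0 \in `[0, 1] -> t1 \in `[0, 1] -> `|t1 - t0| = 1 -> 0 < e ->
  \forall x \near g t0, exists h : R -> M,
    [/\ C1_curve X h, h t0 = x, h t1 = g t1 &
        (curve_length F h <= curve_length F g + e%:E)%E].
Proof.
move=> /C1_curveP[J [oJ IJ gc gC1]] It0 It1 t10 e0.
have Jt0 : J t0 by exact: IJ.
have [i igt0] := atlas_cover X (g t0).
set c0 := cmap (atlas i) \o g; set u0 := cmap (atlas i) (g t0).
have [rho [K [rho0 K0 rhoK]]] := finsler_local_bound F igt0.
pose V := `|derive1 c0 t0| + 1.
have V0 : 0 < V by rewrite ltr_wpDl.
(* In this time window only half of the radius [rho] is used; the other half is left for the
   displacement [w]. *)
have [d0 /= d00 d0P] : exists2 d0 : R, 0 < d0 & forall t, `|t - t0| < d0 ->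
    [/\ J t, cdom (atlas i) (g t), `|c0 t - u0| < rho / 2 &
        `|derive1 c0 t| <= V].
  have [_ c'c] := gC1 i t0 Jt0 igt0.
  have cc := C1_at_continuous (gC1 i t0 Jt0 igt0).
  have N : \forall t \near t0, [/\ J t, cdom (atlas i) (g t),
      `|c0 t - u0| < rho / 2 & `|derive1 c0 t| <= V].
    near=> t; split.
    - by near: t; exact: open_nbhs_nbhs.
    - by near: t; exact: gc _ Jt0 _ (chart_nbhs igt0).
    - by rewrite distrC; near: t; move/cvgrPdist_lt : cc; apply; rewrite divr_gt0.
    - have H : `|derive1 c0 t0 - derive1 c0 t| < 1.
        by near: t; move/cvgrPdist_lt : c'c; apply.
      rewrite /V -lerBlDl; apply: le_trans (ltW H).
      by rewrite distrC lerB_dist.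
  have [d0 d00 d0P] := (nbhs_ballP _ _).1 N.
  by exists d0 => // t tt0; apply: d0P; rewrite -ball_normE/= distrC.
(* Bounds the speed of the perturbed curve: [V] for the chart speed of [c0], and 1 for the cutoff
   term, since [|w| < d / 4] and the derivative of the cutoff is at most 4 / d. *)
pose L := K * (V + 1).
have L0 : 0 < L by rewrite mulr_gt0// addr_gt0.
(* [d < d0] keeps the change inside the window, [d < 1] leaves the other endpoint fixed, and the
   last condition bounds the cost of a piece of duration at most 2d and speed at most [L]. *)
have [d [dpos dd0 d1 dL]] : exists d : R, [/\ 0 < d, d < d0, d < 1 & L * (d + d) <= e].
  exists (Num.min (d0 / 2) (Num.min (1 / 2) (e / (2 * L)))).
  set d := Num.min _ _.
  have h1 : d <= d0 / 2 by rewrite ge_min lexx.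
  have h2 : d <= 1 / 2 by rewrite !ge_min lexx !orbT.
  have h3 : d <= e / (2 * L) by rewrite !ge_min lexx !orbT.
  split.
  - by rewrite !lt_min !divr_gt0// mulr_gt0.
  - by apply: le_lt_trans h1 _; rewrite gtr_pMr// invf_lt1// ltr1n.
  - by apply: le_lt_trans h2 _; lra.
  - rewrite ler_pdivlMr in h3; last by rewrite mulr_gt0.
    by apply: le_trans h3; rewrite mulrDr; lra.
have cmc : {for g t0, continuous (cmap (atlas i))} by exact: cmap_continuous.
near=> x.
have ix : cdom (atlas i) x by near: x; exact: chart_nbhs.
set w := cmap (atlas i) x - u0.
have wrho : `|w| < rho / 2.
  rewrite /w distrC; near: x.
  by move/cvgrPdist_lt : cmc; apply; rewrite divr_gt0.
have wd : `|w| < d / 4.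
  rewrite /w distrC; near: x.
  by move/cvgrPdist_lt : cmc; apply; rewrite divr_gt0.
(* At [t0] the displacement is all of [w] and the curve reaches [x]. For d <= |t - t0| < d0 the
   cutoff vanishes and both branches of [h] agree. *)
pose c t := c0 t + cutoff t0 d t *: w.
pose h t := if `|t - t0| < d0 then cinv (atlas i) (c t) else g t.
have crho t : `|t - t0| < d0 -> `|c t - u0| < rho.
  move=> /d0P[_ _ ct _].
  have -> : c t - u0 = (c0 t - u0) + cutoff t0 d t *: w by rewrite /c addrAC.
  apply: le_lt_trans (ler_normD _ _) _; rewrite (splitr rho) ltrD//.
  rewrite normrZ; apply: le_lt_trans wrho; rewrite ler_piMl//.
  by have /andP[b0 b1] := cutoff_itv t0 d t; rewrite ger0_norm.
have cimg t : `|t - t0| < d0 -> (cmap (atlas i) @` cdom (atlas i)) (c t).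
  by move=> tt0; have [] := rhoK (c t) 0 (crho t tt0).
have ihc t : `|t - t0| < d0 ->
    cdom (atlas i) (h t) /\ cmap (atlas i) (h t) = c t.
  move=> tt0; rewrite /h tt0; have [y iy <-] := cimg t tt0.
  by rewrite cmapK.
have hg t : d <= `|t - t0| -> h t = g t.
  move=> dt; rewrite /h; case: ifPn => // tt0.
  rewrite /c cutoff_out// scale0r addr0 /c0/= cmapK//.
  by have [] := d0P t tt0.
have cn t : {for t, continuous (fun s : R => `|s - t0|)}.
  by apply: cvg_norm; apply: cvgB; [exact: cvg_id|exact: cvg_cst].
have near_in t : `|t - t0| < d0 -> \forall s \near t, `|s - t0| < d0.
  exact: (cvgr_lt _ (cn t)).
have near_out t : d < `|t - t0| -> \forall s \near t, h s = g s.
  move=> dt; have : \forall s \near t, d < `|s - t0| by exact: (cvgr_gt _ (cn t)).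
  apply: filterS => s ds.
  by apply: hg; exact: ltW.
have cC1 t : `|t - t0| < d0 -> C1_at c t.
  move=> /d0P[Jt igt _ _]; apply: C1_at_addZ; first exact: gC1.
  exact: C1_at_cutoff.
(* As d < d0, the open sets d < |t - t0| and |t - t0| < d0 cover all times, so near each time [h] is
   either [g] or its expression in the chart. *)
have hC t : J t -> {for t, continuous h} /\
    forall j, cdom (atlas j) (h t) -> C1_at (cmap (atlas (s := X) j) \o h) t.
  move=> Jt; have [dt|td] := ltP d `|t - t0|.
    have ng := near_out t dt.
    have gh : \forall s \near t, g s = h s by apply: filterS ng.
    split.
      rewrite /prop_for /continuous_at (nbhs_singleton ng).
      by apply: cvg_trans (gc t Jt); exact: (near_eq_cvg gh).
    move=> j; rewrite (nbhs_singleton ng) => jgt.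
    apply: C1_at_near_eq (gC1 j t Jt jgt).
    by apply: filterS gh => s /= ->.
  have tt0 : `|t - t0| < d0 := le_lt_trans td dd0.
  have ht : h t = cinv (atlas i) (c t) by rewrite /h tt0.
  have nh : \forall s \near t, cinv (atlas i) (c s) = h s.
    by apply: filterS (near_in t tt0) => s st; rewrite /h st.
  split.
    rewrite /prop_for /continuous_at ht.
    apply: cvg_trans; first exact: (near_eq_cvg nh).
    apply: (@continuous_comp _ _ _ c (cinv (atlas i))).
      exact: C1_at_continuous (cC1 t tt0).
    by apply: cinv_continuous; exact: cimg.
  move=> j jht; have [iht cht] := ihc t tt0.
  apply: (@C1_at_near_eq _ _ (transition (atlas i) (atlas j) \o c)).
    by apply: filterS nh => s /= <-.
  exact: (C1_at_transition iht jht (esym cht) (cC1 t tt0)).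
have speed t : J t -> d < `|t - t0| ->
    F (h t) (velocity (X := X) h t) = F (g t) (velocity (X := X) g t).
  move=> Jt dt; have ng := near_out t dt.
  by rewrite (near_eq_velocity _ ng) (nbhs_singleton ng).
have speedL t : J t -> `|t - t0| <= d -> F (h t) (velocity (X := X) h t) <= L.
  move=> Jt td; have tt0 : `|t - t0| < d0 := le_lt_trans td dd0.
  have [iht cht] := ihc t tt0; have [hc hC1] := hC t Jt.
  have /cC1[/nbhs_singleton dc _] := tt0.
  have ch : \forall s \near t, c s = (cmap (atlas i) \o h) s.
    by apply: filterS (near_in t tt0) => s st; have [] := ihc s st.
  have [/nbhs_singleton dh _] := hC1 i iht.
  have vE := velocityE iht hc dh.
  rewrite vE.
  rewrite -(near_eq_derive1 ch) {1 2}/h tt0.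
  have [_] := rhoK (c t) (derive1 c t) (crho t tt0).
  move=> /le_trans; apply; rewrite ler_pM2l//.
  have [Jt' igt _ c'V] := d0P t tt0.
  have [/nbhs_singleton dc0 _] := gC1 i t Jt igt.
  have db := is_derive_cutoff t0 d t.
  have dp : derivable (cutoff t0 d) t 1 by case: db.
  have -> : derive1 c t = derive1 c0 t + cutoff' t0 d t *: w.
    rewrite (derive1_addZ w dc0 dp) (derive1E (cutoff t0 d)).
    by case: db => _ ->.
  apply: le_trans (ler_normD _ _) _; rewrite lerD// normrZ.
  have -> : 1 = 4 / d * (d / 4) by field; lra.
  by rewrite ler_pM// ?(ltW wd)// cutoff'_bound.
exists h; split.
- apply/C1_curveP; exists J; split => // [t /hC[]|j t Jt jht] //.
  by have [_] := hC t Jt; apply.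
- by rewrite /h subrr normr0 d00 /c cutoff_center scale1r /w addrC subrK cmapK.
- by apply: hg; rewrite t10 ltW.
(* [b] absorbs the speed of [h] on the modified piece; elsewhere [h] and [g] have the same speed. *)
pose b t : R := L * \1_(`[t0 - d, t0 + d]%classic) t.
have b0 t : 0 <= b t by rewrite mulr_ge0 ?(ltW L0)// indicE.
have mb : measurable_fun [set: R] b.
  by apply: measurable_funM => //; exact: measurable_indic.
have inI t : (`[t0 - d, t0 + d]%classic t) = (`|t - t0| <= d) :> Prop.
  by rewrite /= in_itv/= ler_distl.
apply: (@le_trans _ _ (curve_length F g +
    \int[lebesgue_measure]_(t in `[0%R, 1%R]) (b t)%:E)%E).
  apply: ge0_integral_le_addr => //.
  - exact: measurable_funTS.
  - move=> t /IJ Jt; rewrite lee_fin; have [hc hC1] := hC t Jt.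
    exact: velocity_finsler_ge0.
  - move=> t /IJ Jt; rewrite lee_fin.
    by apply: velocity_finsler_ge0 => //; [exact: gc|move=> j; exact: gC1].
  - move=> t /IJ Jt; rewrite -EFinD lee_fin /b indicE.
    have [td|dt] := leP `|t - t0| d.
      rewrite mem_set ?inI// mulr1; apply: le_trans (speedL t Jt td) _.
      rewrite lerDr; apply: velocity_finsler_ge0 => //; [exact: gc|].
      by move=> j; exact: gC1.
    rewrite memNset ?inI; last by apply/negP; rewrite -ltNge.
    by rewrite mulr0 addr0 speed.
rewrite leeD2l//; apply: (@le_trans _ _ (L * (d + d))%:E); last first.
  by rewrite lee_fin.
apply: le_trans (ge0_subset_integral _ _ _ _ _ (@subsetT _ _)) _ => //.
- exact/measurable_EFinP.
- by move=> t _; rewrite lee_fin.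
rewrite /b; under eq_integral do rewrite EFinM.
rewrite ge0_integralZl//=; last 2 first.
- exact/measurable_EFinP/measurable_indic.
- by rewrite lee_fin ltW.
rewrite integral_indic// setIT [leRHS]EFinM lee_pmul2l//.
rewrite [leLHS](lebesgue_measure_itv `[t0 - d, t0 + d]) /=.
by case: ifPn => _; rewrite lee_fin; lra.
Unshelve. all: by end_near. Qed.

End perturbation.

(** * The Finsler distance *)

Section distance.
Context (R : realType) (n : nat) (M : ptopologicalType).
Context (X : smooth_manifold R n M) (F : finsler_metric X).

Lemma curve_length_ge0 (g : R -> M) : C1_curve X g -> (0 <= curve_length F g)%E.
Proof.
move=> /C1_curveP[J [_ IJ gc gC1]]; apply: integral_ge0 => t /IJ Jt.
by rewrite lee_fin; apply: velocity_finsler_ge0 => [|i]; [exact: gc|exact: gC1].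
Qed.

(** The slack in the strict inequality pays for moving the endpoint. Leaving open which of 0 and 1
    is [t0] serves both arguments of the asymmetric distance. *)
Lemma finsler_dist_near (t0 t1 : R) (g : R -> M) (r : R) :
  C1_curve X g -> t0 \in `[0, 1] -> t1 \in `[0, 1] -> `|t1 - t0| = 1 ->
  (curve_length F g < r%:E)%E ->
  \forall x \near g t0, exists h, [/\ C1_curve X h, h t0 = x, h t1 = g t1 &
    (curve_length F h < r%:E)%E].
Proof.
move=> gC1 It0 It1 t10 gr.
have [l lE] : exists l, curve_length F g = l%:E.
  have := curve_length_ge0 gC1; case: (curve_length F g) gr => // l _ _.
  by exists l.
rewrite lE lte_fin in gr.
have e0 : 0 < (r - l) / 2 by rewrite divr_gt0// subr_gt0.
apply: filterS (endpoint_perturbation F gC1 It0 It1 t10 e0) => x [h [hC1 hx ht1 hl]].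
exists h; split => //; apply: le_lt_trans hl _.
by rewrite lE -EFinD lte_fin; lra.
Qed.

Lemma finsler_dist_near_target z x (r : R) : (finsler_dist F z x < r%:E)%E ->
  \forall y \near x, (finsler_dist F z y < r%:E)%E.
Proof.
move=> /ereal_inf_lt[_ [g [gC1 g0 g1] <-] gr].
have := @finsler_dist_near 1 0 g r gC1 _ _ _ gr.
rewrite g1 g0 sub0r normrN1 !bound_itvE => /(_ ler01 ler01 erefl).
apply: filterS => y [h [hC1 h1 h0 hr]]; apply: le_lt_trans hr.
by apply: ereal_inf_lbound; exists h.
Qed.

Lemma finsler_dist_near_source x z (r : R) : (finsler_dist F x z < r%:E)%E ->
  \forall y \near x, (finsler_dist F y z < r%:E)%E.
Proof.
move=> /ereal_inf_lt[_ [g [gC1 g0 g1] <-] gr].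
have := @finsler_dist_near 0 1 g r gC1 _ _ _ gr.
rewrite g1 g0 subr0 normr1 !bound_itvE => /(_ ler01 ler01 erefl).
apply: filterS => y [h [hC1 h1 h0 hr]]; apply: le_lt_trans hr.
by apply: ereal_inf_lbound; exists h.
Qed.

Lemma finsler_distxx x : (finsler_dist F x x <= 0)%E.
Proof.
have C1x (i : chart_index X) (t : R) : C1_at (cmap (atlas i) \o cst x) t.
  exact: (C1_at_cst (cmap (atlas i) x) t).
have xC1 : C1_curve X (cst x).
  apply/C1_curveP; exists setT; split => [|//|t _|i t _ _].
  - exact: openT.
  - exact: cst_continuous.
  - exact: C1x.
apply: (@le_trans _ _ (curve_length F (cst x))).
  by apply: ereal_inf_lbound; exists (cst x).
rewrite /curve_length integral0_eq// => t _.
have [i ix] := atlas_cover X x.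
rewrite (@velocityE _ _ _ X (cst x) t i)//; last first.
- by have [/nbhs_singleton] := C1x i t.
- exact: cst_continuous.
by rewrite (_ : derive1 _ _ = 0) ?finsler_tvec0//; exact: (derive1_cst (cmap (atlas i) x)).
Qed.

(** A forward ball is the union over [z] in [A] of the sets where the distance from [z] is below
    [r], each open by [finsler_dist_near_target]. *)
Lemma fwd_ball_open (A : set M) r : open (fwd_ball F A r).
Proof.
rewrite openE => x /ereal_inf_lt[_ [z Az <-] zr].
apply: filterS (finsler_dist_near_target zr) => y zy.
by apply: le_lt_trans zy; apply: ereal_inf_lbound; exists z.
Qed.

Lemma bwd_ball_open (A : set M) r : open (bwd_ball F A r).
Proof.
rewrite openE => x /ereal_inf_lt[_ [z Az <-] zr].
apply: filterS (finsler_dist_near_source zr) => y zy.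
by apply: le_lt_trans zy; apply: ereal_inf_lbound; exists z.
Qed.

(** The Lipschitz bound is one-sided and the distance asymmetric, so each side of the estimate uses
    its own direction: moving the target or moving the source away from [x]. *)
Lemma one_lipschitz_continuous (f : M -> R) : one_lipschitz F f -> continuous f.
Proof.
move=> lf x; apply/cvgrPdist_lt => e e0.
have xe : (finsler_dist F x x < e%:E)%E by apply: le_lt_trans (finsler_distxx x) _.
near=> y; rewrite ltr_norml; apply/andP; split.
  have : (finsler_dist F x y < e%:E)%E by near: y; exact: finsler_dist_near_target.
  by move=> /(le_lt_trans (lf x y)); rewrite lte_fin; lra.
have : (finsler_dist F y x < e%:E)%E by near: y; exact: finsler_dist_near_source.
by move=> /(le_lt_trans (lf y x)); rewrite lte_fin; lra.
Unshelve. all: by end_near. Qed.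

Lemma one_lipschitz_measurable (f : borel M -> R) :
  one_lipschitz F f -> measurable_fun [set: borel M] f.
Proof.
move=> lf; apply: (measurability _ (RGenOInfty.measurableE R)) => _ [_ [x ->] <-].
rewrite setTI; apply: sub_sigma_algebra.
by apply: open_comp; [move=> y _; exact: one_lipschitz_continuous|rewrite set_itvE; exact: open_gt].
Qed.

Lemma borel_open (A : set M) : open A -> measurable (A : set (borel M)).
Proof. exact: sub_sigma_algebra. Qed.

Lemma fwd_ball_sublevel (f : M -> R) (A : set M) t r : one_lipschitz F f ->
  (forall x, A x -> f x <= t) -> fwd_ball F A r `<=` [set x | f x < t + r].
Proof.
move=> lf At x /ereal_inf_lt[_ [z Az <-] zr] /=.
by have := At z Az; move: (le_lt_trans (lf z x) zr); rewrite lte_fin; lra.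
Qed.

Lemma bwd_ball_superlevel (f : M -> R) (A : set M) t r : one_lipschitz F f ->
  (forall x, A x -> t <= f x) -> bwd_ball F A r `<=` [set x | t - r < f x].
Proof.
move=> lf At x /ereal_inf_lt[_ [z Az <-] zr] /=.
by have := At z Az; move: (le_lt_trans (lf x z) zr); rewrite lte_fin; lra.
Qed.

End distance.

(** * Exponential tails and moments *)

Section exponential_tails.
Context d (T : measurableType d) (R : realType) (mu : {measure set T -> \bar R}).
Hypothesis mu1 : mu [set: T] = 1%E.
Local Open Scope ereal_scope.

Lemma mass_le1 A : measurable A -> mu A <= 1.
Proof. by move=> mA; rewrite -mu1 le_measure ?inE. Qed.

Lemma mass_fin_num A : measurable A -> mu A \is a fin_num.
Proof.
by move=> mA; rewrite ge0_fin_numE// (le_lt_trans (mass_le1 mA))// ltry.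
Qed.

Lemma mass_setC A : measurable A -> mu (~` A) = 1 - mu A.
Proof.
move=> mA; rewrite -mu1 -(setvU A) measureU ?setICl//; last exact: measurableC.
by rewrite addeK// mass_fin_num.
Qed.

Lemma measurable_preimage_itv (f : T -> R) (i : interval R) :
  measurable_fun [set: T] f -> measurable (f @^-1` [set` i]).
Proof. by move=> mf; rewrite -[X in measurable X]setTI; exact: mf. Qed.

Lemma measurable_sublevel (f : T -> R) t :
  measurable_fun [set: T] f -> measurable [set x | (f x <= t)%R].
Proof.
by move=> /(measurable_preimage_itv `]-oo, t]); under eq_set do rewrite /= in_itv/=.
Qed.

Lemma measurable_superlevel (f : T -> R) t :
  measurable_fun [set: T] f -> measurable [set x | (t <= f x)%R].
Proof.
move=> /(measurable_preimage_itv `[t, +oo[).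
by under eq_set do rewrite /= in_itv/= andbT.
Qed.

(** The sublevel sets at the integers increase to the whole space, so their masses tend to 1. *)
Lemma sublevel_mass_gt_half (f : T -> R) : measurable_fun [set: T] f ->
  exists N : nat, 2^-1%:E < mu [set x | (f x <= N%:R)%R].
Proof.
move=> mf; pose E n := [set x | (f x <= n%:R)%R].
have mE n : measurable (E n) by exact: measurable_sublevel.
have cE : mu \o E @ \oo --> mu (\bigcup_n E n).
  apply: nondecreasing_cvg_mu => //; first exact: bigcup_measurable.
  move=> i j ij; apply/subsetPset => x /= /le_trans; apply; by rewrite ler_nat.
have UE : \bigcup_n E n = [set: T].
  apply/seteqP; split => // x _; exists (Num.truncn `|f x|).+1 => //=.
  by apply: le_trans (ler_norm _) _; apply/ltW; exact: truncnS_gt.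
rewrite UE mu1 in cE.
have h1 : (2^-1%:E : \bar R) < 1 by rewrite lte_fin; lra.
apply/not_existsP => H; have : 1 <= 2^-1%:E :> \bar R; last by rewrite leNgt h1.
rewrite -(cvg_lim _ cE)//; apply: lime_le; first by apply/cvg_ex; exists 1.
by apply: nearW => n /=; rewrite leNgt; apply/negP; exact: H.
Qed.

(** An approximate median: any [t] in [S] within 1 of its infimum will do, so it need not be shown
    that the infimum is attained. The unit gap only affects constants. *)
Lemma quantile_unit_gap (f : T -> R) : measurable_fun [set: T] f ->
  exists t : R, 2^-1%:E <= mu [set x | (f x <= t)%R] /\
                2^-1%:E <= mu [set x | (t - 1 <= f x)%R].
Proof.
move=> mf.
pose S : set R := [set t | 2^-1%:E <= mu [set x | (f x <= t)%R]].
have [N Nh] := sublevel_mass_gt_half mf.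
have mNf : measurable_fun [set: T] (fun x => - f x)%R by exact: measurableT_comp.
have [N' N'h] := sublevel_mass_gt_half mNf.
(* Below [- N'%:R] the sublevel set misses a set of mass above 1/2, hence has mass below 1/2. *)
have lbS : lbound S (- N'%:R)%R.
  move=> t; rewrite /S/= leNgt => h; rewrite leNgt; apply/negP => tN'.
  move: h; apply/negP; rewrite negbK.
  apply: (@le_lt_trans _ _ (mu (~` [set x | (- f x <= N'%:R)%R]))).
    rewrite le_measure ?inE//.
    - exact: measurable_sublevel.
    - exact/measurableC/measurable_sublevel.
    - by move=> x /= ft; apply/negP; rewrite -ltNge; lra.
  rewrite mass_setC; last exact: measurable_sublevel.
  rewrite lteBlDl ?mass_fin_num//; last exact: measurable_sublevel.
  rewrite -lteBlDr//; apply: le_lt_trans N'h.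
  by rewrite -EFinB lee_fin; lra.
have [t St tS] : exists2 t, S t & (t < inf S + 1)%R.
  apply: inf_adherent => //; split; last by exists (- N'%:R)%R.
  by exists N%:R => /=; exact: ltW.
exists t; split=> //.
have tS' : ~ S (t - 1)%R.
  by move=> /ge_inf -/(_ (ex_intro _ _ lbS)); lra.
have {}tS' : mu [set x | (f x <= t - 1)%R] < 2^-1%:E.
  by rewrite ltNge; apply/negP.
apply: (@le_trans _ _ (mu (~` [set x | (f x <= t - 1)%R]))); last first.
  rewrite le_measure ?inE//.
  - exact/measurableC/measurable_sublevel.
  - exact: measurable_superlevel.
  - by move=> x /= /negP; rewrite -ltNge => /ltW.
rewrite mass_setC; last exact: measurable_sublevel.
rewrite leeBrDl ?mass_fin_num//; last exact: measurable_sublevel.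
rewrite -leeBrDr//; apply: (le_trans (ltW tS')).
by rewrite -EFinB lee_fin; lra.
Qed.

(** Slice by the integer part of [Y]. The tails decay at rate 2a while the integrand grows at rate
    a, so the slices are bounded by a geometric series of ratio [expR (- a)]. *)
Lemma expR_moment (Y : T -> R) (a B : R) :
  measurable_fun [set: T] Y -> (forall x, 0 <= Y x)%R -> (0 < a)%R -> (0 <= B)%R ->
  (forall k : nat, mu [set x | (k%:R <= Y x)%R] <= (B * expR (- (a * 2 * k%:R)))%:E) ->
  \int[mu]_x (expR (a * Y x))%:E <= (B * expR a / (1 - expR (- a)))%:E.
Proof.
move=> mY Y0 a0 B0 tail.
have mge k : measurable [set x | (k%:R <= Y x)%R] by exact: measurable_superlevel.
(* Where k <= Y < k + 1, the single term [u k] already dominates the integrand; this is why its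
   exponent has [k.+1]. *)
pose u (k : nat) x : \bar R := (expR (a * k.+1%:R) * \1_[set x | (k%:R <= Y x)%R] x)%:E.
have u0 k x : 0 <= u k x by rewrite lee_fin mulr_ge0 ?expR_ge0// indicE.
have mu_ k : measurable_fun [set: T] (u k).
  by apply/measurable_EFinP/measurable_funM => //; exact: measurable_indic.
apply: (@le_trans _ _ (\int[mu]_x \sum_(k <oo) u k x)).
  apply: ge0_le_integral_nonmeas => x _; first by rewrite lee_fin expR_ge0.
  have /andP[k1 k2] := truncn_itv (Y0 x).
  set k := Num.truncn (Y x) in k1 k2.
  apply: (@le_trans _ _ (\sum_(0 <= i < k.+1) u i x)); last first.
    by apply: nneseries_lim_ge => i _ _; exact: u0.
  rewrite big_nat_recr//= -[leLHS]add0e leeD//.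
    by apply: sume_ge0 => i _; exact: u0.
  by rewrite /u lee_fin indicE mem_set// mulr1 ler_expR ler_pM2l// ltW.
rewrite integral_nneseries//.
have z1 : (`|expR (- a)| < 1)%R by rewrite ger0_norm ?expR_ge0// expR_lt1 oppr_lt0.
apply: lime_le.
  by apply: is_cvg_nneseries => k _ _; apply: integral_ge0 => x _; exact: u0.
apply: nearW => k.
apply: (@le_trans _ _ (series (geometric (B * expR a)%R (expR (- a))) k)%:E); last first.
  by rewrite lee_fin geometric_le_lim// ?expR_gt0// mulr_ge0// expR_ge0.
rewrite /series/= -sumEFin; apply: lee_sum => i _.
rewrite /u; under eq_integral do rewrite EFinM.
rewrite ge0_integralZl//=; last exact/measurable_EFinP/measurable_indic.
rewrite integral_indic// setIT.
apply: (le_trans (lee_wpmul2l _ (tail i))); first by rewrite lee_fin expR_ge0.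
rewrite -EFinM lee_fin -expRM_natl mulrCA -!mulrA -!expRD.
rewrite le_eqVlt; apply/orP; left; apply/eqP; congr (_ * expR _)%R.
by rewrite -natr1; ring.
Qed.

End exponential_tails.

Section moments.
Context d (T : measurableType d) (R : realType) (mu : {measure set T -> \bar R}).
Hypothesis mu1 : mu [set: T] = 1%E.
Variables (f : T -> R) (t a E : R).
Hypotheses (mf : measurable_fun [set: T] f) (a0 : 0 < a).
Hypothesis fE : (\int[mu]_x (expR (a * `|f x - t|))%:E <= E%:E)%E.

Let measurable_dev : measurable_fun [set: T] (fun x => f x - t).
Proof. by apply: measurable_funB. Qed.

Let measurable_absdev : measurable_fun [set: T] (fun x => `|f x - t|).
Proof. exact: (measurableT_comp (@normr_measurable R setT)). Qed.

(** From 1 + y <= exp y, hence a y <= exp (a y). *)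
Lemma integral_absdev_le : (\int[mu]_x (`|f x - t|)%:E <= (E / a)%:E)%E.
Proof.
apply: (@le_trans _ _ (\int[mu]_x (a^-1%:E * (expR (a * `|f x - t|))%:E))%E).
  apply: ge0_le_integral_nonmeas => x _; first by rewrite lee_fin.
  rewrite -EFinM lee_fin ler_pdivlMl//.
  by apply: le_trans (expR_ge1Dx _); rewrite lerDr.
rewrite ge0_integralZl//=; last 2 first.
- apply/measurable_EFinP/measurableT_comp => //.
  exact: measurable_funM.
- by rewrite lee_fin invr_ge0 ltW.
by rewrite [in leRHS]mulrC EFinM lee_wpmul2l// lee_fin invr_ge0 ltW.
Qed.

Let integrable_cst_mass (k : R) : mu.-integrable [set: T] (EFin \o cst k).
Proof.
apply/integrableP; split; first exact/measurable_EFinP.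
under eq_integral do rewrite /= .
by rewrite integral_cst// mu1 mule1 ltry.
Qed.

Let integrable_dev : mu.-integrable [set: T] (EFin \o (fun x => f x - t)).
Proof.
apply/integrableP; split; first exact/measurable_EFinP.
by apply: le_lt_trans integral_absdev_le _; rewrite ltry.
Qed.

Lemma integrable_of_exp_moment : mu.-integrable [set: T] (EFin \o f).
Proof.
rewrite (_ : EFin \o f = (EFin \o (fun x => (f x - t)%R)) \+ (EFin \o cst t))%E.
  exact: integrableD.
by apply/funext => x /=; rewrite -EFinD subrK.
Qed.

Lemma mean_dev_le : `|\int[mu]_x f x - t| <= E / a.
Proof.
have -> : \int[mu]_x f x - t = \int[mu]_x (f x - t).
  rewrite RintegralB//; last exact: integrable_cst_mass.
    by rewrite Rintegral_cst// mu1 mulr1.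
  exact: integrable_of_exp_moment.
apply: (le_trans (le_normr_Rintegral _ _)) => //.
rewrite -lee_fin; apply: le_trans integral_absdev_le.
rewrite /Rintegral fineK// ge0_fin_numE; last by apply: integral_ge0.
by apply: le_lt_trans integral_absdev_le _; rewrite ltry.
Qed.

Lemma Lnorm_dev_mean_le (q : R) : 0 < q ->
  (Lnorm mu q%:E (fun x => (f x - \int[mu]_x f x)%R%:E) <=
   (((q / a) `^ q * expR E * E) `^ q^-1)%:E)%E.
Proof.
move=> q0; rewrite unlock -poweR_EFin.
apply: gt0_ler_poweR.
- by rewrite invr_ge0 ltW.
- by rewrite in_itv/= leey andbT integral_ge0// => x _; exact: poweR_ge0.
- rewrite in_itv/= leey andbT lee_fin mulr_ge0 ?mulr_ge0 ?powR_ge0 ?expR_ge0//.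
  rewrite -lee_fin; apply: le_trans fE; apply: integral_ge0 => x _.
  by rewrite lee_fin expR_ge0.
apply: (@le_trans _ _ (\int[mu]_x (((q / a) `^ q * expR E)%:E * (expR (a * `|f x - t|))%:E))%E).
  apply: ge0_le_integral_nonmeas => x _; first exact: poweR_ge0.
  rewrite abse_EFin poweR_EFin -EFinM lee_fin.
  set Y := `|f x - t|.
  have Yg : `|f x - \int[mu]_x f x| <= Y + E / a.
    apply: le_trans (ler_distD t _ _) _; rewrite lerD2l distrC; exact: mean_dev_le.
  (* Scaled so that z q = a Y + E: bounding z by exp z and raising to the power [q] produces exactly
     the exponential whose integral [fE] controls. *)
  pose z := a * (Y + E / a) / q.
  have zE : z * q = a * Y + E by rewrite /z; field; rewrite !gt_eqF.
  have le1 : `|f x - \int[mu]_x f x| <= q / a * expR z.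
    apply: le_trans Yg _.
    have -> : Y + E / a = q / a * z by rewrite /z; field; rewrite !gt_eqF.
    rewrite ler_pM2l ?divr_gt0//; apply: le_trans (expR_ge1Dx _).
    by rewrite lerDr.
  apply: le_trans (ge0_ler_powR _ _ _ le1) _; rewrite ?nnegrE ?(ltW q0)//.
    by rewrite mulr_ge0 ?expR_ge0// divr_ge0 ?ltW.
  rewrite powRM ?expR_ge0 ?divr_ge0 ?(ltW q0) ?(ltW a0)//.
  by rewrite -expRM zE expRD mulrA mulrAC.
rewrite ge0_integralZl//=; last 2 first.
- apply/measurable_EFinP/measurableT_comp => //.
  exact: measurable_funM.
- by rewrite lee_fin mulr_ge0 ?powR_ge0 ?expR_ge0.
by rewrite [in leRHS]EFinM lee_wpmul2l// lee_fin mulr_ge0 ?powR_ge0 ?expR_ge0.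
Qed.

End moments.

(** * Concentration and the tails of 1-Lipschitz functions *)

Section concentration.
Context (R : realType) (n : nat) (M : ptopologicalType).
Context (X : smooth_manifold R n M) (F : finsler_metric X).
Context (m : {measure set (borel M) -> \bar R}).
Hypothesis m1 : m [set: borel M] = 1%E.

Lemma ball_setC_mass_le (A : set (borel M)) (r e : R) :
  measurable A -> ((2^-1)%:E <= m A)%E ->
  (concentration_function F m r <= e%:E)%E ->
  (m (~` fwd_ball F A r) <= e%:E)%E /\ (m (~` bwd_ball F A r) <= e%:E)%E.
Proof.
move=> mA hA ce.
have mf := borel_open (fwd_ball_open F A r).
have mb := borel_open (bwd_ball_open F A r).
have le : (1 - Order.min (m (fwd_ball F A r)) (m (bwd_ball F A r)) <= e%:E)%E.
  by apply: le_trans ce; apply: ereal_sup_ubound; exists A.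
split.
  rewrite (mass_setC m1 mf); apply: le_trans le.
  by rewrite leeB// ge_min lexx.
rewrite (mass_setC m1 mb); apply: le_trans le.
by rewrite leeB// ge_min lexx orbT.
Qed.

(** The two complements of balls contribute 2C. The summand 1 covers k <= 1, where the right-hand
    side is at least the total mass. *)
Lemma one_lipschitz_tail (C c : R) (f : borel M -> R) (t : R) (k : nat) :
  0 < C -> 0 < c ->
  (forall r : R, 0 < r ->
    (concentration_function F m r <= (C * expR (- (c * r)))%:E)%E) ->
  one_lipschitz F f ->
  ((2^-1)%:E <= m [set x | (f x <= t)%R])%E ->
  ((2^-1)%:E <= m [set x | (t - 1 <= f x)%R])%E ->
  (m [set x | (k%:R <= `|f x - t|)%R] <=
     ((2 * C + 1) * expR c * expR (- (c * k%:R)))%:E)%E.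
Proof.
move=> C0 c0 conc lf lo hi.
have mf := one_lipschitz_measurable lf.
have mY : measurable [set x | (k%:R <= `|f x - t|)%R].
  apply: measurable_superlevel.
  by apply: (measurableT_comp (@normr_measurable R setT)); exact: measurable_funB.
have [k1|k2] := leqP k 1.
  apply: le_trans (mass_le1 m1 mY) _; rewrite lee_fin -mulrA -expRD.
  have : 1 <= expR (c - c * k%:R).
    rewrite -[leLHS]expR0 ler_expR subr_ge0 ler_piMr ?(ltW c0)//.
    by rewrite lern1.
  by move: (expR _) => z z1; nra.
(* The radius is k - 1 because the superlevel set starts at t - 1: its backward ball then lies in f
   > t - k. The forward ball of the sublevel set lies in f < t + k - 1. *)
have r0 : 0 < k%:R - 1 :> R by rewrite subr_gt0 ltr1n.
have [F1 _] := ball_setC_mass_le (measurable_sublevel t mf) lo (conc _ r0).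
have [_ B1] := ball_setC_mass_le (measurable_superlevel (t - 1) mf) hi (conc _ r0).
have mF := measurableC (borel_open (fwd_ball_open F [set x | (f x <= t)%R] (k%:R - 1))).
have mB := measurableC (borel_open (bwd_ball_open F [set x | (t - 1 <= f x)%R] (k%:R - 1))).
apply: le_trans (le_measure m _ _ _) _; rewrite ?inE; first exact: mY.
- exact: (measurableU _ _ mF mB).
- move=> x /= kx; have [tx|xt] := leP t (f x).
    left => /(fwd_ball_sublevel lf)-/(_ t (fun _ h => h)) /=.
    by move: kx; rewrite ger0_norm ?subr_ge0//; lra.
  right => /(bwd_ball_superlevel lf)-/(_ (t - 1) (fun _ h => h)) /=.
  by move: kx; rewrite ltr0_norm ?subr_lt0//; lra.
apply: le_trans (measureU2 _ mF mB) _.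
apply: le_trans (leeD F1 B1) _; rewrite -EFinD lee_fin.
have -> : - (c * (k%:R - 1)) = c - c * k%:R by ring.
rewrite -mulrA -expRD; have := expR_ge0 (c - c * k%:R).
by move: (expR _) => z z0; lra.
Qed.

End concentration.

Unset Implicit Arguments.
Theorem theorem3p15 (R : realType) (n : nat) (M : ptopologicalType)
    (X : smooth_manifold R n M) (M_connected : connected [set: M])
    (F : finsler_metric X) (m : {measure set (borel M) -> \bar R})
    (m_smooth : smooth_positive_measure X m)
    (m_total : m [set: borel M] = 1%E)
    (m_exp : exponential_concentration F m)
    (q : R) (q_ge1 : 1 <= q) :
  moment_concentration F m 1 q.
Proof.
case: m_exp => C [c [C0 c0 conc]].
(* Half the concentration rate, as [expR_moment] asks for tails of rate 2a. *)
pose a := c / 2.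
have a0 : 0 < a by rewrite divr_gt0.
pose B := (2 * C + 1) * expR c.
have B0 : 0 < B by rewrite mulr_gt0 ?expR_gt0// addr_gt0// mulr_gt0.
pose E := B * expR a / (1 - expR (- a)).
have E0 : 0 < E.
  have e1 : 0 < 1 - expR (- a) by rewrite subr_gt0 expR_lt1 oppr_lt0.
  by rewrite /E divr_gt0// mulr_gt0// expR_gt0.
have q0 : 0 < q by exact: lt_le_trans q_ge1.
(* The bound of [Lnorm_dev_mean_le]. It depends on [C], [c] and [q] but not on [f], and the constant
   [q / K] turns q / C into [K]. *)
pose K := ((q / a) `^ q * expR E * E) `^ q^-1.
have K0 : 0 < K.
  by rewrite /K powR_gt0// mulr_gt0// mulr_gt0 ?expR_gt0// powR_gt0// divr_gt0.
exists (q / K); split=> [|f lf]; first exact: divr_gt0.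
have mf := one_lipschitz_measurable lf.
have [t [lo hi]] := quantile_unit_gap m_total mf.
have fE : (\int[m]_x (expR (a * `|f x - t|))%:E <= E%:E)%E.
  apply: expR_moment => //; [|exact: ltW|] => [|k].
    by apply: (measurableT_comp (@normr_measurable R setT)); exact: measurable_funB.
  rewrite (_ : a * 2 = c); last by rewrite /a divfK.
  exact: (one_lipschitz_tail m_total k C0 c0 conc lf lo hi).
split; first exact: (integrable_of_exp_moment m_total mf a0 fE).
rewrite poweRe1; last exact: Lnorm_ge0.
rewrite invf_div mulrCA divff ?gt_eqF// mulr1.
exact: (Lnorm_dev_mean_le m_total mf a0 fE q0).
Qed.
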